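(* Let $A\in\mathbb{R}^{n\times n}$ be a $P$-matrix, let $q\in\mathbb{R}^n$, and let $A=M-N$ be a splitting of $A$ with $M,N\in\mathbb{R}^{n\times n}$. Let $\Omega_1,\Omega_2\in\mathbb{R}^{n\times n}$, let $\gamma>0$, let $\Omega_4$ be a positive diagonal matrix, and let $\Omega_3=\frac1\gamma I$. Define $$B=M+\Omega_1-\Omega_2+\gamma\Omega_4,\qquad C=N+\Omega_1-\Omega_2,\qquad G=\gamma\Omega_4-A.$$ Assume that $B$ is nonsingular. If $$\rho\left(|B^{-1}C|+|B^{-1}G|\right)<1,$$ then, for any initial vector $x^{(0)}\in\mathbb{R}^n$, the sequence $\{x^{(k)}\}_{k=0}^\infty$ generated by $$Bx^{(k+1)}=Cx^{(k)}+G|x^{(k)}|-\gamma q,\qquad k=0,1,2,\ldots,$$ converges to a vector $x^\ast$. Consequently, $z^{(k)}=\Omega_3(|x^{(k)}|+x^{(k)})$ converges to the unique solution $z^\ast$ of $\operatorname{LCP}(q,A)$.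
   Context: For $A\in\mathbb{R}^{n\times n}$ and $q\in\mathbb{R}^n$, $\operatorname{LCP}(q,A)$ is the problem of finding $z,w\in\mathbb{R}^n$ with $w=Az+q$, $z\ge 0$, $w\ge 0$, $z^Tw=0$ (inequalities componentwise); $z$ is referred to as the solution. A $P$-matrix is a real square matrix all of whose principal minors are positive. A positive diagonal matrix is a diagonal matrix with positive diagonal entries. $|X|$ denotes the entrywise absolute value of a matrix or vector $X$, and $\rho(X)$ is the spectral radius. *)

(* Defs.v *)
From HB Require Import structures.
From mathcomp Require Import all_boot all_order all_algebra.
From mathcomp Require Import complex.
From mathcomp Require Import all_classical all_reals all_analysis.

Set Implicit Arguments.
Unset Strict Implicit.
Unset Printing Implicit Defensive.

Import Order.TTheory GRing.Theory Num.Theory.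
Import numFieldNormedType.Exports.

Local Open Scope classical_set_scope.
Local Open Scope ring_scope.

Definition absmx (R : realType) (m n : nat) (X : 'M[R]_(m, n)) : 'M[R]_(m, n) :=
  map_mx (Num.norm : R -> R) X.

Definition principal_submx (R : realType) (n : nat) (A : 'M[R]_n)
    (S : {set 'I_n}) : 'M[R]_#|S| :=
  mxsub (fun i : 'I_#|S| => enum_val i) (fun j : 'I_#|S| => enum_val j) A.

Definition P_matrix (R : realType) (n : nat) (A : 'M[R]_n) : Prop :=
  forall S : {set 'I_n}, S != finset.set0 -> 0 < \det (principal_submx A S).

Definition positive_diagonal (R : realType) (n : nat) (D : 'M[R]_n) : Prop :=
  is_diag_mx D /\ forall i, 0 < D i i.

(* The eigenvalues are taken in R[i]. The supremum is over a finite set, hence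
   a maximum; it is 0 when n = 0, by the convention sup set0 = 0. *)
Definition spectral_radius (R : realType) (n : nat) (A : 'M[R]_n) : R :=
  sup [set (ComplexField.Normc.normc l : R) | l in
        [set l : R[i] | eigenvalue (map_mx (real_complex R) A) l]].

Definition lcp_pair (R : realType) (n : nat) (q : 'cV[R]_n) (A : 'M[R]_n)
    (z w : 'cV[R]_n) : Prop :=
  [/\ w = A *m z + q,
      (forall i, 0 <= z i 0),
      (forall i, 0 <= w i 0) &
      z^T *m w = 0].

Definition lcp_solution (R : realType) (n : nat) (q : 'cV[R]_n) (A : 'M[R]_n)
    (z : 'cV[R]_n) : Prop :=
  exists w : 'cV[R]_n, lcp_pair q A z w.

(* Main.v *)
(* A vector x satisfies f x := B^-1 (C x + G |x| - gamma q) = x iff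
   A (|x| + x) + gamma q = gamma Omega4 (|x| - x), that is, iff
   z = (|x| + x) / gamma and w = Omega4 (|x| - x) solve LCP(q, A); every solution
   (z, w) arises this way, from x = (gamma z - Omega4^-1 w) / 2.  Moreover
   |f x - f y| <= T |x - y| with T = |B^-1 C| + |B^-1 G|.  Once the sums
   sum_k |T^k v| are known to be bounded, f has at most one fixed point and its
   iterates have bounded variation, so they converge to that fixed point.  This
   gives the existence and the uniqueness of the LCP solution as well.

   The bound on sum_k |T^k v| comes from Cayley-Hamilton: v is annihilated by the
   product of the T - l over the complex eigenvalues l, and a bound for
   (T - l) v yields one for v because |l| < 1. *)
Require Import Defs.
From mathcomp Require Import all_boot all_order all_algebra.
From mathcomp Require Import complex.
From mathcomp Require Import ring.
From mathcomp Require Import all_classical all_reals all_analysis.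

Import Order.TTheory GRing.Theory Num.Theory.
Import numFieldNormedType.Exports.
Local Open Scope classical_set_scope.
Local Open Scope ring_scope.

(** * Summability of orbits of a matrix with spectral radius below 1 *)

Lemma iter_mulmx_subZ (K : numFieldType) n (T : 'M[K]_n) (v : 'cV[K]_n) l k :
  iter k (mulmx T) (T *m v - l *: v) =
  iter k.+1 (mulmx T) v - l *: iter k (mulmx T) v.
Proof.
elim: k => [//|k IHk]; rewrite iterS IHk mulmxBr -scalemxAr; congr (_ - _).
Qed.

(** Induction on [s]. With u = T v - l v one has T^(k+1) v = l T^k v + T^k u. If b bounds the orbit
    sums of u at entry i and S is a partial sum for v, then S <= |v_i| + |l| S + b, which is solved
    for S since |l| < 1. *)
Lemma bounded_orbit_sum_of_annihilator (K : numFieldType) n (T : 'M[K]_n)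
    (s : seq K) (v : 'cV[K]_n) :
    (forall l, l \in s -> `|l| < 1) ->
    foldl (fun u l => T *m u - l *: u) v s = 0 ->
  forall i, exists2 b : K, 0 <= b &
    forall m, \sum_(0 <= k < m) `|iter k (mulmx T) v i 0| <= b.
Proof.
elim: s v => [|l s IHs] v sltl1 /= anni i.
  exists 0 => // m; rewrite anni big1 // => k _.
  have -> : iter k (mulmx T) 0 = 0 :> 'cV[K]_n.
    by elim: k => // k IHk; rewrite iterS IHk mulmx0.
  by rewrite mxE normr0.
have l1 : 0 < 1 - `|l| by rewrite subr_gt0 sltl1 // mem_head.
have [||b b0 bP] := IHs (T *m v - l *: v) _ _ i => //.
  by move=> a sa; apply: sltl1; rewrite in_cons sa orbT.
exists ((`|v i 0| + b) / (1 - `|l|)).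
  by apply: divr_ge0; [exact: addr_ge0 | exact: ltW].
move=> m; rewrite ler_pdivlMr // mulrBr mulr1 lerBlDr.
set S := \sum_(_ <= _ < _) _.
have : S <= \sum_(0 <= k < m.+1) `|iter k (mulmx T) v i 0|.
  by rewrite big_nat_recr //= lerDl.
move/le_trans; apply; rewrite big_nat_recl // -addrA lerD2l.
rewrite mulr_suml; apply: (le_trans _ (lerD (bP m) (lexx _))).
rewrite -big_split /=; apply: ler_sum => k _.
rewrite -iterS iter_mulmx_subZ; move: (iter k.+1 _ _) (iter k _ _) => y u.
rewrite 3!mxE [_ * `|l|]mulrC -normrM.
by apply: le_trans (ler_normD _ _); rewrite subrK.
Qed.

Lemma bounded_orbit_sum_closed (K : numClosedFieldType) n (T : 'M[K]_n)
    (v : 'cV[K]_n) :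
    (forall l, eigenvalue T l -> `|l| < 1) ->
  forall i, exists2 b : K, 0 <= b &
    forall m, \sum_(0 <= k < m) `|iter k (mulmx T) v i 0| <= b.
Proof.
case: n T v => [|n] T v ev i; first by case: i.
have [s sE] := closed_field_poly_normal (char_poly T).
move: sE; rewrite (monicP (char_poly_monic T)) scale1r => sE.
apply: (@bounded_orbit_sum_of_annihilator _ _ _ s).
  by move=> l ls; apply: ev; rewrite eigenvalue_root_char sE root_prod_XsubC.
(* The factors T - l are polynomials in T and commute, so the fold applies the factored
   characteristic polynomial of T. *)
have foldE u : foldl (fun u l => T *m u - l *: u) u s =
    horner_mx T (\prod_(l <- s) ('X - l%:P)) *m u.
  elim: {sE} s u => [|l s IHs] u /=.
    by rewrite big_nil rmorph1 mul1mx.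
  rewrite IHs big_cons mulrC rmorphM -mulmxE -mulmxA; congr (_ *m _).
  by rewrite rmorphB /= horner_mx_X horner_mx_C mulmxBl mul_scalar_mx.
by rewrite foldE -sE Cayley_Hamilton mul0mx.
Qed.

Lemma normr_eigenvalue_le_spectral_radius (R : realType) n (T : 'M[R]_n) l :
  eigenvalue (map_mx (real_complex R) T) l ->
  `|l| <= (spectral_radius T)%:C%C.
Proof.
move=> evl.
have -> : `|l| = (ComplexField.Normc.normc l)%:C%C by case: (l).
rewrite lecR.
apply: ub_le_sup; last by exists l.
have [s sE] :=
  closed_field_poly_normal (char_poly (map_mx (real_complex R) T)).
move: sE; rewrite (monicP (char_poly_monic _)) scale1r => sE.
have normc_ge0 a : 0 <= ComplexField.Normc.normc a :> R.
  by case: a => a b; apply: sqrtr_ge0.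
(* [sup] dominates its set only when the set is bounded above; the sum of the moduli of all
   characteristic roots is such a bound. *)
exists (\sum_(a <- s) ComplexField.Normc.normc a) => _ [a /= eva <-].
have as_ : a \in s by move: eva; rewrite eigenvalue_root_char sE root_prod_XsubC.
rewrite (big_rem a) //= lerDl; apply: sumr_ge0 => c _; exact: normc_ge0.
Qed.

Lemma bounded_orbit_sum (R : realType) n (T : 'M[R]_n) (v : 'cV[R]_n) :
    spectral_radius T < 1 ->
  forall i, exists b : R,
    forall m, \sum_(0 <= k < m) `|iter k (mulmx T) v i 0| <= b.
Proof.
move=> rho i.
have [|b b0 bP] := @bounded_orbit_sum_closed _ _ (map_mx (real_complex R) T)
  (map_mx (real_complex R) v) _ i.
  move=> l /normr_eigenvalue_le_spectral_radius /le_lt_trans; apply.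
  by rewrite ltcR.
(* The complex bound [b] is nonnegative, hence real. *)
exists (complex.Re b) => m; rewrite -lecR.
have -> : (complex.Re b)%:C%C = b by rewrite RRe_real // ger0_real.
apply: le_trans (bP m); rewrite rmorph_sum /=; apply: ler_sum => k _.
have -> : iter k (mulmx (map_mx (real_complex R) T)) (map_mx (real_complex R) v)
    = map_mx (real_complex R) (iter k (mulmx T) v).
  by elim: k => // k IHk; rewrite !iterS IHk map_mxM.
by rewrite mxE normc_def /= expr0n addr0 sqrtr_sqr.
Qed.

(** A nonnegative [T] preserves entrywise order. Used with [e] constant for uniqueness of fixed
    points, and with [e] the successive differences of the iterates for convergence. *)
Lemma le_iter_mulmx (R : realType) n (T : 'M[R]_n) (e : nat -> 'cV[R]_n) :
    (forall i j, 0 <= T i j) ->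
    (forall k i, e k.+1 i 0 <= (T *m e k) i 0) ->
  forall k i, e k i 0 <= iter k (mulmx T) (e 0%N) i 0.
Proof.
move=> T0 eT; elim=> // k IHk i; apply: le_trans (eT k i) _.
by rewrite iterS !mxE; apply: ler_sum => j _; apply: ler_wpM2l.
Qed.

Lemma cvg_mx (T : topologicalType) m n (u : nat -> 'M[T]_(m, n))
    (p : 'M[T]_(m, n)) :
  (forall i j, u k i j @[k --> \oo] --> p i j) -> u k @[k --> \oo] --> p.
Proof.
move=> up A [P pP sPA].
have : \forall k \near \oo, forall i j, P i j (u k i j).
  apply: filter_forall => i; apply: filter_forall => j.
  by have /(_ _ (pP i j)) := up i j.
by apply: filterS => k; exact: sPA.
Qed.

(** The series of increments converges absolutely, and telescoping recovers [u] from it. *)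
Lemma cvg_of_bounded_variation (R : realType) (u : nat -> R) (b : R) :
  (forall m, \sum_(0 <= k < m) `|u k.+1 - u k| <= b) -> cvgn u.
Proof.
move=> ub.
have : cvgn (series (fun k => u k.+1 - u k)).
  apply: normed_cvg; apply: nondecreasing_is_cvgn.
    apply/nondecreasing_seqP => k.
    by rewrite [leRHS](seriesSr (fun k => `|u k.+1 - u k|)) lerDl.
  by exists b => _ [m _ <-]; apply: ub.
move=> cvs; have -> : u = fun k => series (fun k => u k.+1 - u k) k + u 0%N.
  by apply/funext => k; rewrite /series /= telescope_sumr // subrK.
by apply: is_cvgD => //; apply: is_cvg_cst.
Qed.

Lemma absmx_subE (R : realType) m n (x y : 'M[R]_(m, n)) i j :
  absmx (x - y) i j = `|x i j - y i j|.
Proof. by rewrite !mxE. Qed.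

(** * Fixed points of maps contracting in the entrywise absolute value *)

Section AbsmxContraction.
Context {R : realType} {n : nat}.
Variables (T : 'M[R]_n) (f : 'cV[R]_n -> 'cV[R]_n).
Hypothesis T_ge0 : forall i j, 0 <= T i j.
Hypothesis rho_lt1 : spectral_radius T < 1.
Hypothesis f_contr :
  forall x y i, absmx (f x - f y) i 0 <= (T *m absmx (x - y)) i 0.

Lemma fixpoint_unique x y : f x = x -> f y = y -> x = y.
Proof.
move=> fx fy; apply/matrixP => i j; rewrite (ord1 j); apply/eqP.
rewrite -subr_eq0 -normr_eq0 eq_le normr_ge0 andbT.
have [b bP] := bounded_orbit_sum _ _ T (absmx (x - y)) rho_lt1 i.
(* For fixed points, |x - y| <= T |x - y|, so |x - y| lies below its whole orbit under T. *)
have dom k : `|x i 0 - y i 0| <= `|iter k (mulmx T) (absmx (x - y)) i 0|.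
  rewrite -absmx_subE; apply: le_trans (ler_norm _).
  have := le_iter_mulmx _ _ T (fun=> absmx (x - y)) T_ge0 _ k i.
  apply=> _ l; rewrite -[in leLHS]fx -[in leLHS]fy; exact: f_contr.
(* A positive entry d would satisfy m d <= b for every m, against the Archimedean property. *)
rewrite leNgt; apply/negP => d0.
have {}bP m : `|x i 0 - y i 0| *+ m <= b.
  apply: le_trans (bP m); rewrite -[in leLHS](subn0 m) -sumr_const_nat.
  by apply: ler_sum => k _; apply: dom.
have := bP (Num.bound (b / `|x i 0 - y i 0|)).
rewrite -mulr_natl -ler_pdivlMr // leNgt => /negP; apply.
by apply: le_lt_trans (archi_boundP _); rewrite ?ler_norm //;
  apply: divr_ge0 => //; exact: bP 0%N.
Qed.

Lemma iterates_cvg (x : nat -> 'cV[R]_n) :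
  (forall k, x k.+1 = f (x k)) ->
  exists2 p, f p = p & forall i, x k i 0 @[k --> \oo] --> p i 0.
Proof.
move=> xS.
have cvx i : cvgn (fun k => x k i 0).
  have [b bP] := bounded_orbit_sum _ _ T (absmx (x 1%N - x 0%N)) rho_lt1 i.
  apply: (@cvg_of_bounded_variation _ _ b) => m; apply: le_trans (bP m).
  apply: ler_sum => k _; rewrite -absmx_subE; apply: le_trans (ler_norm _).
  have := le_iter_mulmx _ _ T (fun k => absmx (x k.+1 - x k)) T_ge0 _ k i.
  by apply=> l h; have := f_contr (x l.+1) (x l) h; rewrite -!xS.
pose p : 'cV[R]_n := \col_i limn (fun k => x k i 0).
have xp i : x k i 0 @[k --> \oo] --> p i 0 by rewrite mxE; exact: cvx.
exists p => //.
apply/matrixP => i j; rewrite (ord1 j).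
have xSp : x k.+1 i 0 @[k --> \oo] --> p i 0.
  by have := xp i; rewrite -(cvg_shiftS (fun k => x k i 0)).
(* The shifted iterates also tend to f p, because |f x_k - f p| <= T |x_k - p| and the right side
   tends to 0. *)
apply: (cvg_unique _ _ xSp) => //.
apply/subr_cvg0/norm_cvg0P.
apply: (@squeeze_cvgr _ _ _ _ (fun=> 0)
  (fun k => (T *m absmx (x k - p)) i 0)); last 2 first.
- exact: cvg_cst.
- have -> : (fun k => (T *m absmx (x k - p)) i 0) =
      (fun k => \sum_j T i j * `|x k j 0 - p j 0|).
    by apply/funext => k; rewrite mxE; apply: eq_bigr => l _; rewrite absmx_subE.
  rewrite [X in _ --> X](_ : 0 = \sum_(l < n) T i l * 0); last first.
    by rewrite big1 // => l _; rewrite mulr0.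
  apply: cvg_big => [|l _]; first exact: add_continuous.
  apply: cvgM; first exact: cvg_cst.
  by apply/norm_cvg0P/subr_cvg0; exact: xp.
- apply: nearW => k; rewrite normr_ge0 xS /=.
  by rewrite -absmx_subE; exact: f_contr.
Qed.

End AbsmxContraction.

(** * The modulus equation and its correspondence with LCP solutions *)

Lemma absmx_mulmx_le (R : realType) m n (U : 'M[R]_(m, n)) (v : 'cV[R]_n) i :
  absmx (U *m v) i 0 <= (absmx U *m absmx v) i 0.
Proof.
rewrite !mxE; apply: le_trans (ler_norm_sum _ _ _) _.
by apply: ler_sum => j _; rewrite !mxE normrM.
Qed.

Lemma diag_mulmx_cV (R : realType) n (D : 'M[R]_n) (v : 'cV[R]_n) i :
  is_diag_mx D -> (D *m v) i 0 = D i i * v i 0.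
Proof.
move=> /is_diag_mxP Ddiag; rewrite mxE (bigD1 i) //= big1 ?addr0 // => j ji.
by rewrite Ddiag ?mul0r // eq_sym.
Qed.

Lemma lcp_pair_mul0 (R : realType) n (q : 'cV[R]_n) (A : 'M[R]_n) z w :
  lcp_pair q A z w -> forall i, z i 0 * w i 0 = 0.
Proof.
case=> _ z0 w0 /matrixP /(_ 0 0); rewrite !mxE => zw i.
have zw_ge0 j : true -> 0 <= z^T 0 j * w j 0 by rewrite mxE mulr_ge0.
by move/psumr_eq0P: zw => /(_ zw_ge0 i isT); rewrite mxE.
Qed.

Section Modulus.
Context {R : realType} {n : nat}.
Variables (A D : 'M[R]_n) (q : 'cV[R]_n) (gamma : R).
Hypotheses (D_diag : positive_diagonal D) (gamma_gt0 : 0 < gamma).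

Definition modulus_eq (x : 'cV[R]_n) : Prop :=
  A *m (absmx x + x) + gamma *: q = gamma *: (D *m (absmx x - x)).

Lemma lcp_solution_of_modulus_eq x :
  modulus_eq x -> lcp_solution q A (gamma^-1 *: (absmx x + x)).
Proof.
have [Dd D0] := D_diag.
move=> xE; exists (D *m (absmx x - x)); split.
- apply: (scalerI (lt0r_neq0 gamma_gt0)).
  by rewrite -xE scalerDr -scalemxAr scalerA divff ?scale1r // lt0r_neq0.
- move=> i; rewrite !mxE; apply: mulr_ge0; first by rewrite invr_ge0 ltW.
  by rewrite -lerBlDr sub0r -normrN ler_norm.
- move=> i; rewrite diag_mulmx_cV // !mxE; apply: mulr_ge0; first exact: ltW.
  by rewrite subr_ge0 ler_norm.
(* Complementarity is (|t| + t)(|t| - t) = |t|^2 - t^2 = 0 in each coordinate. *)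
- apply/matrixP => i j; rewrite (ord1 i) (ord1 j) !mxE big1 // => k _.
  rewrite diag_mulmx_cV // !mxE.
  have : `|x k 0| ^+ 2 = x k 0 ^+ 2 by rewrite real_normK // num_real.
  move: `|_| => a aE.
  rewrite [LHS](_ : _ = gamma^-1 * D k k * (a ^+ 2 - x k 0 ^+ 2)); last by ring.
  by rewrite aE subrr mulr0.
Qed.

Lemma modulus_eq_of_lcp_solution z : lcp_solution q A z ->
  exists2 x, modulus_eq x & z = gamma^-1 *: (absmx x + x).
Proof.
have [Dd D0] := D_diag.
case=> w zw; have zw0 := lcp_pair_mul0 _ _ _ _ _ _ zw.
case: zw => wE z0 w0 _.
pose x : 'cV[R]_n := \col_i ((gamma * z i 0 - w i 0 / D i i) / 2).
(* Both terms are nonnegative and complementarity makes one of them vanish, so the modulus of their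
   half-difference is their half-sum. *)
have absx i : `|x i 0| = (gamma * z i 0 + w i 0 / D i i) / 2.
  have gz : 0 <= gamma * z i 0 by rewrite mulr_ge0 // ltW.
  have wd : 0 <= w i 0 / D i i by rewrite divr_ge0 // ltW.
  rewrite mxE; have /eqP := zw0 i; rewrite mulf_eq0 => /orP[] /eqP ->.
    rewrite mulr0 sub0r add0r mulNr normrN ger0_norm // divr_ge0 //.
  by rewrite mul0r subr0 addr0 ger0_norm // divr_ge0.
have xD : absmx x + x = gamma *: z.
  by apply/matrixP => i j; rewrite (ord1 j) 2!mxE absx !mxE; field; rewrite lt0r_neq0.
have xB : D *m (absmx x - x) = w.
  apply/matrixP => i j; rewrite (ord1 j) diag_mulmx_cV // 2!mxE absx !mxE.
  by field; rewrite lt0r_neq0.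
exists x; last by rewrite xD scalerA mulVf ?scale1r // lt0r_neq0.
by rewrite /modulus_eq xD xB wE -scalemxAr scalerDr.
Qed.

End Modulus.

(** * Convergence of the modulus iteration *)

Theorem theorem4p1 (R : realType) (n : nat)
    (A M N : 'M[R]_n) (q : 'cV[R]_n)
    (Omega1 Omega2 Omega3 Omega4 B C G : 'M[R]_n) (gamma : R)
    (hA : P_matrix A)
    (hsplit : A = M - N)
    (hgamma : 0 < gamma)
    (hOmega4 : positive_diagonal Omega4)
    (hOmega3 : Omega3 = (1 / gamma) *: 1%:M)
    (hB : B = M + Omega1 - Omega2 + gamma *: Omega4)
    (hC : C = N + Omega1 - Omega2)
    (hG : G = gamma *: Omega4 - A)
    (hBunit : B \in unitmx)
    (hrho : spectral_radius (absmx (invmx B *m C) + absmx (invmx B *m G)) < 1) :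
  exists zstar : 'cV[R]_n,
    unique (lcp_solution q A) zstar /\
    forall (x0 : 'cV[R]_n) (x : nat -> 'cV[R]_n),
      x 0%N = x0 ->
      (forall k : nat,
         B *m x k.+1 = C *m x k + G *m absmx (x k) - gamma *: q) ->
      (exists xstar : 'cV[R]_n, x k @[k --> \oo] --> xstar) /\
      (Omega3 *m (absmx (x k) + x k)) @[k --> \oo] --> zstar.
Proof.
pose f x := invmx B *m (C *m x + G *m absmx x - gamma *: q).
set T := (absmx _ + absmx _) in hrho.
have T_ge0 i j : 0 <= T i j by rewrite !mxE addr_ge0.
have f_contr x y i : absmx (f x - f y) i 0 <= (T *m absmx (x - y)) i 0.
  have -> : f x - f y = invmx B *m C *m (x - y)
      + invmx B *m G *m (absmx x - absmx y).
    rewrite /f -mulmxBr -!mulmxA -mulmxDr !(mulmxBr C, mulmxBr G).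
    congr (_ *m _); move: (C *m x) (C *m y) (G *m _) (G *m _) => a b c d.
    by apply/matrixP => k l; rewrite !mxE; ring.
  rewrite mulmxDl [leRHS]mxE [leLHS]mxE [X in `|X|]mxE.
  apply: le_trans (ler_normD _ _) (lerD _ _).
    by have := absmx_mulmx_le _ _ _ (invmx B *m C) (x - y) i; rewrite [leLHS]mxE.
  (* The modulus term is handled by the reverse triangle inequality, entry by entry. *)
  have := absmx_mulmx_le _ _ _ (invmx B *m G) (absmx x - absmx y) i.
  rewrite [leLHS]mxE => /le_trans; apply.
  rewrite !mxE; apply: ler_sum => j _; rewrite ler_wpM2l //.
    by rewrite mxE.
  by rewrite !mxE; exact: ler_dist_dist.
have fE x y : B *m y = C *m x + G *m absmx x - gamma *: q <-> y = f x.
  split=> [E|->]; first by rewrite /f -E mulKmx.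
  by rewrite /f mulKVmx.
have fixE x : f x = x <-> modulus_eq A Omega4 q gamma x.
  (* Omega1 and Omega2 cancel in B - C, and M - N becomes A. *)
  have E : B *m x - (C *m x + G *m absmx x - gamma *: q) =
     A *m (absmx x + x) + gamma *: q - gamma *: (Omega4 *m (absmx x - x)).
    rewrite hB hC hG hsplit !(mulmxDl, mulmxBl, mulmxDr, mulmxBr, mulNmx, mulmxN).
    rewrite -!scalemxAl.
    move: (M *m _) (N *m _) (M *m _) (N *m _) (Omega1 *m _) (Omega2 *m _) => a b c d e g.
    move: (Omega4 *m _) (Omega4 *m _) => h k.
    by apply/matrixP => i j; rewrite !mxE; ring.
  split=> [fx|xE].
    by apply/eqP; rewrite -subr_eq0 -E subr_eq0; apply/eqP/fE.
  by apply/esym/fE/eqP; rewrite -subr_eq0 E subr_eq0; apply/eqP.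
(* The orbit of 0 provides a fixed point before any sequence is given, hence a solution of the LCP;
   every later limit is identified with this [p]. *)
have [p fp _] := iterates_cvg _ _ T_ge0 hrho f_contr (fun k => iter k f 0) (fun k => erefl).
exists (gamma^-1 *: (absmx p + p)); split.
  split; first by apply/(lcp_solution_of_modulus_eq _ Omega4)/fixE.
  move=> z /(modulus_eq_of_lcp_solution _ _ _ _ hOmega4 hgamma)[x /fixE fx ->].
  by rewrite (fixpoint_unique _ _ T_ge0 hrho f_contr _ _ fx fp).
move=> x0 x _ xS.
have [p' fp'] := iterates_cvg _ _ T_ge0 hrho f_contr x
  (fun k => (fE _ _).1 (xS k)).
rewrite (fixpoint_unique _ _ T_ge0 hrho f_contr _ _ fp' fp) => xp.
split; first by exists p; apply: cvg_mx => i j; rewrite (ord1 j).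
apply: cvg_mx => i j; rewrite (ord1 j) hOmega3 div1r.
have -> : (fun k => (gamma^-1 *: 1%:M *m (absmx (x k) + x k)) i 0) =
    (fun k => gamma^-1 * (`|x k i 0| + x k i 0)).
  by apply/funext => k; rewrite -scalemxAl mul1mx !mxE.
rewrite !mxE; apply: cvgM; first exact: cvg_cst.
by apply: cvgD; [apply: cvg_norm|]; exact: xp.
Qed.
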